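(* Let $K$ be a non-algebraically closed infinite field. Let $w(\lambda)=\dfrac{u(\lambda)}{v(\lambda)}$ be a rational function on $\mathbb PK^1$ (with $u,v$ polynomials over $K$) such that $v(0)\ne0$. Then $w$ is the characteristic function of a certain element of $\mathrm{Coll}_\infty(1)$.
   Context: An $\infty\times\infty$ matrix $g$ over $K$ is called finite if $g-1$ has only finitely many nonzero entries. $\mathrm{Coll}_\infty(1)$ is the set of finite block matrices $g=\begin{pmatrix}a&b\\c&d\end{pmatrix}$ over $K$ of size $(1+\infty)\times(1+\infty)$ ($a$ is $1\times1$), up to conjugation by matrices $\begin{pmatrix}1&0\\0&u\end{pmatrix}$ with $u$ a finite invertible $\infty\times\infty$ matrix over $K$. The characteristic function of (the class of) $g$ is the rational function $\chi_g(\lambda)=a+\lambda b(1-\lambda d)^{-1}c$; it does not depend on the representative. Equivalently, $g$ is represented by a block matrix $\begin{pmatrix}a&b\\c&d\end{pmatrix}$ of some finite size $1+N$, completed by $1$'s on the diagonal, and $\chi_g$ is given by the same formula for this finite matrix. *)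

(* Defs.v *)
From mathcomp Require Import all_boot all_order all_algebra.
From mathcomp Require Import generic_quotient fraction.
From mathcomp Require Import finmap.
From mathcomp Require Import mathcomp_extra boolp classical_sets functions.
From mathcomp Require Import cardinality fsbigop.

Set Implicit Arguments.
Unset Strict Implicit.
Unset Printing Implicit Defensive.

Import GRing.Theory.
Local Open Scope ring_scope.
Local Open Scope quotient_scope.

(* Infinite matrices g, indexed by nat, such that g - 1 has finitely many
   nonzero entries: the default value of the finitely supported function is
   the identity matrix.  In the block decomposition of size 1 + infinity, the
   index 0 is the first block and the indices i.+1 form the second one. *)
Definition finmx (K : fieldType) :=
  {fsfun nat * nat -> K of ij => (ij.1 == ij.2)%:R}.

Section Coll.
Variable K : fieldType.
Local Notation infmx := (nat -> nat -> K).
Implicit Types (A B C : infmx) (g h u v : finmx K) (N : nat).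

Definition entries g : infmx := fun i j => g (i, j).

Definition infmx1 : infmx := fun i j => (i == j)%:R.

(* The sum is the finitely supported sum of fsbigop; it is genuine whenever
   A and B are finite, since A i k is then nonzero for finitely many k. *)
Definition infmx_mul A B : infmx :=
  fun i j => \sum_(k \in [set: nat]) A i k * B k j.

Definition block1 A : infmx := fun i j =>
  match i, j with
  | 0, 0 => 1
  | i'.+1, j'.+1 => A i' j'
  | _, _ => 0
  end.

Definition coll_equiv g h : Prop :=
  exists u v : finmx K,
    [/\ infmx_mul (entries u) (entries v) = infmx1,
        infmx_mul (entries v) (entries u) = infmx1
      & entries h = infmx_mul (infmx_mul (block1 (entries u)) (entries g))
                              (block1 (entries v))].

(* g differs from the identity only at rows and columns 0, ..., N for
   N = coll_size g, i.e. in a corner of size 1 + N. *)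
Definition coll_size g : nat := \max_(ij <- finsupp g) maxn ij.1 ij.2.

Definition ratC : {rmorphism K -> {fraction {poly K}}} := @tofrac {poly K} \o @polyC K.
Definition lambda : {fraction {poly K}} := tofrac 'X.

Section Corner.
Variables (N : nat) (g : finmx K).
Definition coll_a : K := g (0, 0)%N.
Definition coll_b : 'rV[K]_N := \row_j g (0, j.+1)%N.
Definition coll_c : 'cV[K]_N := \col_i g (i.+1, 0)%N.
Definition coll_d : 'M[K]_N := \matrix_(i, j) g (i.+1, j.+1)%N.

Definition corner_char : {fraction {poly K}} :=
  ratC coll_a +
  lambda * (map_mx ratC coll_b
            *m invmx (1%:M - lambda *: map_mx ratC coll_d)
            *m map_mx ratC coll_c) 0 0.
End Corner.

Definition finmx_char g : {fraction {poly K}} := corner_char (coll_size g) g.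

Definition bounded N A :=
  forall i j, (N <= i)%N || (N <= j)%N -> A i j = (i == j)%:R.

Lemma bounded_le N M A : (N <= M)%N -> bounded N A -> bounded M A.
Proof.
move=> NM bA i j /orP[] H; apply: bA; first by rewrite (leq_trans NM H).
by rewrite (leq_trans NM H) orbT.
Qed.

Lemma bounded_entries g : bounded (coll_size g).+1 (entries g).
Proof.
move=> i j H; rewrite /entries fsfun_dflt //.
apply/negP => ijg; move: H.
have : (maxn i j <= coll_size g)%N.
  rewrite /coll_size.
  exact: (leq_bigmax_seq (i, j) (F := fun ij => maxn ij.1 ij.2)).
by rewrite geq_max => /andP[ii jj] /orP[] H; [move: ii | move: jj]; rewrite leqNgt H.
Qed.

Lemma bounded1 N : bounded N infmx1. Proof. by []. Qed.

Lemma bounded_block1 N A : bounded N A -> bounded N.+1 (block1 A).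
Proof. by move=> bA [|i] [|j] //= H; rewrite eqSS; apply: bA. Qed.

Lemma infmx_mulE N A B : bounded N A -> bounded N B -> infmx_mul A B =
  fun i j => if (i < N)%N && (j < N)%N then \sum_(k < N) A i k * B k j
             else (i == j)%:R.
Proof.
move=> bA bB; apply/funext => i; apply/funext => j; rewrite /infmx_mul.
set M := (maxn N (maxn i j).+1).
have [NM iM jM] : [/\ N <= M, i < M & j < M]%N.
  by rewrite /M !leq_max !ltnS !leq_max !leqnn ?orbT; split.
have bA' := bounded_le NM bA; have bB' := bounded_le NM bB.
have -> : \sum_(k \in [set: nat]) A i k * B k j
          = \sum_(k \in `I_M) A i k * B k j.
  symmetry; apply: fsbig_widen => // k [_ kM].
  have {}kM : (M <= k)%N by rewrite leqNgt; exact/negP.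
  by rewrite /= [B _ _]bB' ?kM // (gtn_eqF (leq_trans jM kM)) mulr0.
rewrite -fsbig_ord.
case: ifPn => [/andP[iN jN]|].
  rewrite -(subnKC NM) big_split_ord /= [X in _ + X]big1 ?addr0 // => k _.
  by rewrite bA ?leq_addr ?orbT // ltn_eqF ?mul0r // (leq_trans iN) ?leq_addr.
rewrite negb_and -2!leqNgt => /orP[iN|jN].
  rewrite (bigD1 (Ordinal iM)) //= big1 ?addr0 => [|k /eqP kne].
    by rewrite bA ?iN // eqxx mul1r bB ?iN.
  rewrite bA ?iN //; case: eqP => [e|]; rewrite ?mul0r //.
  by case: kne; apply: val_inj; rewrite /= e.
rewrite (bigD1 (Ordinal jM)) //= big1 ?addr0 => [|k /eqP kne].
  by rewrite [B _ _]bB ?jN ?orbT // eqxx mulr1 bA ?jN ?orbT.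
rewrite [B _ _]bB ?jN ?orbT //; case: eqP => [e|]; rewrite ?mulr0 //.
by case: kne; apply: val_inj; rewrite /= e.
Qed.

Lemma bounded_mul N A B : bounded N A -> bounded N B ->
  bounded N (infmx_mul A B).
Proof.
move=> bA bB i j H; rewrite (infmx_mulE bA bB); case: ifP => //.
by move: H => /orP[]; rewrite leqNgt => /negPf -> //=; rewrite andbF.
Qed.

Definition corner N A : 'M[K]_N := \matrix_(i, j) A i j.

Lemma corner_mul N A B : bounded N A -> bounded N B ->
  corner N (infmx_mul A B) = corner N A *m corner N B.
Proof.
move=> bA bB; apply/matrixP => i j; rewrite !mxE (infmx_mulE bA bB) !ltn_ord /=.
by apply: eq_bigr => k _; rewrite !mxE.
Qed.

Lemma corner1 N : corner N infmx1 = 1%:M.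
Proof. by apply/matrixP => i j; rewrite !mxE. Qed.

Lemma corner_inj N A B : bounded N A -> bounded N B ->
  corner N A = corner N B -> A = B.
Proof.
move=> bA bB e; apply/funext => i; apply/funext => j.
have [/andP[iN jN]|] := boolP ((i < N)%N && (j < N)%N).
  by move/matrixP/(_ (Ordinal iN) (Ordinal jN)): e; rewrite !mxE.
by rewrite negb_and -2!leqNgt => H; rewrite bA ?bB.
Qed.

Definition finitary A := exists N, bounded N A.

Lemma finitary_entries g : finitary (entries g).
Proof. by exists (coll_size g).+1; exact: bounded_entries. Qed.

Lemma finitary_block1 A : finitary A -> finitary (block1 A).
Proof. by case=> N /bounded_block1; exists N.+1. Qed.

Lemma finitary2 A B : finitary A -> finitary B ->
  exists2 N, bounded N A & bounded N B.
Proof.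
move=> [N bA] [M bB]; exists (maxn N M).
  exact: bounded_le (leq_maxl _ _) bA.
exact: bounded_le (leq_maxr _ _) bB.
Qed.

Lemma finitary_mul A B : finitary A -> finitary B -> finitary (infmx_mul A B).
Proof.
by move=> fA fB; have [N bA bB] := finitary2 fA fB; exists N; apply: bounded_mul.
Qed.

Lemma infmx_mulA A B C : finitary A -> finitary B -> finitary C ->
  infmx_mul A (infmx_mul B C) = infmx_mul (infmx_mul A B) C.
Proof.
move=> fA fB [M bC]; have [N bA bB] := finitary2 fA fB.
have {}bA := bounded_le (leq_maxl N M) bA.
have {}bB := bounded_le (leq_maxl N M) bB.
have {}bC := bounded_le (leq_maxr N M) bC.
apply: (@corner_inj (maxn N M)); rewrite ?corner_mul ?mulmxA //;
  by do ?apply: bounded_mul.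
Qed.

Lemma infmx_mul1 A : finitary A -> infmx_mul A infmx1 = A.
Proof.
case=> N bA; apply: (@corner_inj N) => //; first exact: bounded_mul.
by rewrite corner_mul // corner1 mulmx1.
Qed.

Lemma infmx_1mul A : finitary A -> infmx_mul infmx1 A = A.
Proof.
case=> N bA; apply: (@corner_inj N) => //; first exact: bounded_mul.
by rewrite corner_mul // corner1 mul1mx.
Qed.

Lemma corner_block1 N A :
  corner N.+1 (block1 A) = block_mx (1%:M : 'M_1) 0 0 (corner N A) :> 'M_(1 + N).
Proof.
apply/matrixP => i j.
case: (@split_ordP 1 N i) => i' ->; case: (@split_ordP 1 N j) => j' ->;
  rewrite ?block_mxEul ?block_mxEur ?block_mxEdl ?block_mxEdr !mxE /=;
  by rewrite ?(ord1 i') ?(ord1 j').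
Qed.

Lemma block1M A B : finitary A -> finitary B ->
  block1 (infmx_mul A B) = infmx_mul (block1 A) (block1 B).
Proof.
move=> fA fB; have [N bA bB] := finitary2 fA fB.
apply: (@corner_inj N.+1).
- exact/bounded_block1/bounded_mul.
- by apply: bounded_mul; apply: bounded_block1.
rewrite corner_mul; [|exact: bounded_block1|exact: bounded_block1].
rewrite !corner_block1 (@mulmx_block _ 1 N 1 N 1 N) corner_mul //.
by rewrite !mulmx0 !mul0mx mulmx1 !(addr0, add0r).
Qed.

Lemma block11 : block1 infmx1 = infmx1.
Proof. by apply/funext => -[|i]; apply/funext => -[|j]. Qed.

Lemma entries_surj A : finitary A -> exists g, entries g = A.
Proof.
case=> N bA; exists [fsfun ij in
  [fset ij in [seq (i, j) | i <- iota 0 N, j <- iota 0 N]]%fset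
    => A ij.1 ij.2 | (ij.1 == ij.2)%:R].
apply/funext => i; apply/funext => j; rewrite /entries fsfun_fun.
case: ifPn => //; rewrite inE /=; apply: contraNeq => Aij.
apply/allpairsP; exists (i, j); rewrite /= !mem_iota !add0n /=.
split=> //; rewrite ltnNge; apply: contra_neqN Aij => H; rewrite bA ?H ?orbT //.
Qed.

Lemma entries1 : exists g, entries g = infmx1.
Proof. by apply: entries_surj; exists 0%N. Qed.

Local Hint Resolve finitary_entries finitary_block1 finitary_mul : core.

Lemma coll_equiv_refl g : coll_equiv g g.
Proof.
have [e He] := entries1; have fe := finitary_entries e.
exists e, e; rewrite He block11 -He.
by rewrite He infmx_mul1 ?infmx_1mul ?infmx_mul1; try split; try by exists 0%N.
Qed.

Lemma coll_equiv_sym g h : coll_equiv g h -> coll_equiv h g.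
Proof.
move=> [u [v [uv vu hE]]]; exists v, u; split=> //.
have BE : infmx_mul (block1 (entries v)) (block1 (entries u)) = infmx1.
  by rewrite -block1M // vu block11.
rewrite hE -!infmx_mulA; auto 7.
rewrite BE infmx_mul1; auto 7.
by rewrite infmx_mulA; auto; rewrite BE infmx_1mul.
Qed.

Lemma coll_equiv_trans g h k :
  coll_equiv g h -> coll_equiv h k -> coll_equiv g k.
Proof.
move=> [u [v [uv vu hE]]] [u' [v' [uv' vu' kE]]].
have [p pE] := entries_surj (finitary_mul (finitary_entries u') (finitary_entries u)).
have [q qE] := entries_surj (finitary_mul (finitary_entries v) (finitary_entries v')).
exists p, q; rewrite pE qE; split.
- rewrite -infmx_mulA; auto.
  rewrite [infmx_mul (entries u) _]infmx_mulA; auto.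
  by rewrite uv infmx_1mul.
- rewrite -infmx_mulA; auto.
  rewrite [infmx_mul (entries v') _]infmx_mulA; auto.
  by rewrite vu' infmx_1mul.
- by rewrite kE hE !block1M; auto; rewrite !infmx_mulA; auto 7.
Qed.

Lemma resolvent_unitmx N (d : 'M[K]_N) :
  1%:M - lambda *: map_mx ratC d \in unitmx.
Proof.
pose p : 'M[{poly K}]_N := 1%:M - 'X *: map_mx polyC d.
have -> : 1%:M - lambda *: map_mx ratC d = map_mx (@tofrac _) p.
  by rewrite /p map_mxB map_mx1 map_mxZ -map_mx_comp.
rewrite unitmxE det_map_mx unitfE tofrac_eq0.
suff : (\det p).[0] != 0 by apply: contraNneq => ->; rewrite horner0.
have -> : (\det p).[0] = \det (map_mx (horner_eval 0) p).
  by rewrite det_map_mx.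
have -> : map_mx (horner_eval 0) p = 1%:M.
  apply/matrixP => i j; rewrite !mxE /horner_eval /= !hornerE.
  by rewrite -?[1 *+ _]polyCMn ?hornerE ?mul0r ?subr0.
by rewrite det1 oner_neq0.
Qed.

Lemma corner_char_addn N k g : bounded N.+1 (entries g) ->
  corner_char (N + k) g = corner_char N g.
Proof.
move=> bg.
have bgE i j : (N < i)%N || (N < j)%N -> g (i, j) = (i == j)%:R by exact: bg.
have bE : coll_b (N + k) g = row_mx (coll_b N g) 0.
  apply/rowP => j; case: (split_ordP j) => j' ->.
    by rewrite row_mxEl !mxE.
  by rewrite row_mxEr !mxE bgE //= ltnS leq_addr.
have cE : coll_c (N + k) g = col_mx (coll_c N g) 0.
  apply/colP => j; case: (split_ordP j) => j' ->.
    by rewrite col_mxEu !mxE.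
  by rewrite col_mxEd !mxE bgE //= ltnS leq_addr.
have dE : coll_d (N + k) g = block_mx (coll_d N g) 0 0 1%:M.
  apply/matrixP => i j; case: (split_ordP i) => i' ->;
    case: (split_ordP j) => j' ->;
    rewrite ?block_mxEul ?block_mxEur ?block_mxEdl ?block_mxEdr !mxE //=.
  - by rewrite bgE ?ltnS ?leq_addr ?orbT // eqSS ltn_eqF // ltn_addr.
  - by rewrite bgE ?ltnS ?leq_addr // eqSS gtn_eqF // ltn_addr.
  - by rewrite bgE ?ltnS ?leq_addr // eqSS eqn_add2l.
rewrite /corner_char; congr (_ + _ * _).
set P := 1%:M - lambda *: map_mx ratC (coll_d (N + k) g).
set Q := 1%:M - lambda *: map_mx ratC (coll_d N g).
pose x := invmx Q *m map_mx ratC (coll_c N g).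
have -> : map_mx ratC (coll_b (N + k) g) *m invmx P
    *m map_mx ratC (coll_c (N + k) g)
  = row_mx (map_mx ratC (coll_b N g)) (0 : 'rV_k) *m col_mx x 0.
  rewrite bE map_row_mx map_mx0 -mulmxA; congr (_ *m _).
  apply: (canLR (mulKmx (resolvent_unitmx (coll_d (N + k) g)))).
  rewrite cE map_col_mx map_mx0 dE map_block_mx !map_mx0 map_mx1.
  rewrite (scalar_mx_block N k 1) scale_block_mx opp_block_mx add_block_mx mul_block_col.
  rewrite !mulmx0 !addr0 !scaler0 !oppr0 !addr0 !mul0mx.
  by rewrite /x mulKVmx // resolvent_unitmx.
by rewrite mul_row_col mul0mx addr0 /x mulmxA.
Qed.

Lemma corner_charE N g : bounded N.+1 (entries g) ->
  finmx_char g = corner_char N g.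
Proof.
move=> bg; rewrite /finmx_char -(corner_char_addn N (@bounded_entries g)).
by rewrite addnC (corner_char_addn _ bg).
Qed.

Lemma corner_block N g :
  corner N.+1 (entries g) =
  block_mx (const_mx (coll_a g)) (coll_b N g) (coll_c N g) (coll_d N g)
  :> 'M_(1 + N).
Proof.
apply/matrixP => i j.
case: (@split_ordP 1 N i) => i' ->; case: (@split_ordP 1 N j) => j' ->;
  rewrite ?block_mxEul ?block_mxEur ?block_mxEdl ?block_mxEdr !mxE /=;
  by rewrite ?(ord1 i') ?(ord1 j').
Qed.

Lemma resolvent_conj N (b : 'rV[{fraction {poly K}}]_N) (c : 'cV_N)
    (P p q : 'M_N) :
  p \in unitmx -> q \in unitmx -> P \in unitmx ->
  b *m q *m invmx (p *m P *m q) *m (p *m c) = b *m invmx P *m c.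
Proof.
move=> pu qu Pu; set Q := p *m P *m q.
have Qu : Q \in unitmx by rewrite !unitmx_mul pu Pu qu.
have QE : invmx q *m (invmx P *m c) = invmx Q *m (p *m c).
  apply: (canRL (mulKmx Qu)).
  by rewrite /Q -!mulmxA (mulKVmx qu) (mulKVmx Pu).
by rewrite -[LHS]mulmxA -QE -!mulmxA (mulKVmx qu).
Qed.

Lemma finmx_char_equiv g h : coll_equiv g h -> finmx_char g = finmx_char h.
Proof.
move=> [u [v [uv vu hE]]].
have [N1 bu bv] := finitary2 (finitary_entries u) (finitary_entries v).
have [N2 bg bh] := finitary2 (finitary_entries g) (finitary_entries h).
pose N := maxn N1 N2.
have {}bu : bounded N (entries u) := bounded_le (leq_maxl _ _) bu.
have {}bv : bounded N (entries v) := bounded_le (leq_maxl _ _) bv.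
have NN : (N2 <= N.+1)%N by rewrite leqW // leq_maxr.
have {}bg := bounded_le NN bg; have {}bh := bounded_le NN bh.
rewrite (corner_charE bg) (corner_charE bh) /corner_char.
set U := corner N (entries u); set V := corner N (entries v).
have UV : U *m V = 1%:M by rewrite -corner_mul // uv corner1.
have [Uu Vu] : U \in unitmx /\ V \in unitmx by exact: mulmx1_unit.
have := congr1 (corner N.+1) hE.
rewrite !corner_mul; try by do ?[exact: bounded_block1 | apply: bounded_mul].
rewrite !corner_block1 !corner_block !(@mulmx_block _ 1 N 1 N 1 N).
rewrite !mul0mx !mulmx0 !mul1mx !mulmx1 !(addr0, add0r).
case/(@eq_block_mx _ 1 N 1 N) => aE -> -> ->.
have {}aE : coll_a h = coll_a g by move/matrixP/(_ 0 0): aE; rewrite !mxE.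
rewrite aE; congr (_ + _ * _).
rewrite !map_mxM.
set u' := map_mx ratC U; set v' := map_mx ratC V.
have u'v' : u' *m v' = 1%:M by rewrite -map_mxM UV map_mx1.
set P := 1%:M - lambda *: map_mx ratC (coll_d N g).
have Pu : P \in unitmx by exact: resolvent_unitmx.
have [u'u v'u] := mulmx1_unit u'v'.
have -> : 1%:M - lambda *: (u' *m map_mx ratC (coll_d N g) *m v')
          = u' *m P *m v'.
  by rewrite mulmxBr mulmxBl mulmx1 u'v' -scalemxAr -scalemxAl.
move: P Pu u'u v'u {u'v'}; rewrite {}/u' {}/v'.
move: (map_mx ratC U) (map_mx ratC V) (map_mx ratC (coll_b N g)).
move: (map_mx ratC (coll_c N g)) => c p q b P Pu pu qu.
exact: esym (congr1 (fun M : 'M_1 => M 0 0) (resolvent_conj b c pu qu Pu)).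
Qed.

Definition coll_equivb g h : bool := `[< coll_equiv g h >].

Lemma coll_equivb_refl : reflexive coll_equivb.
Proof. by move=> g; apply/asboolP; exact: coll_equiv_refl. Qed.

Lemma coll_equivb_sym : symmetric coll_equivb.
Proof. by move=> g h; apply/asboolP/asboolP; exact: coll_equiv_sym. Qed.

Lemma coll_equivb_trans : transitive coll_equivb.
Proof.
move=> h g k /asboolP gh /asboolP hk; apply/asboolP.
exact: coll_equiv_trans gh hk.
Qed.

Canonical coll_equiv_rel :=
  EquivRel coll_equivb coll_equivb_refl coll_equivb_sym coll_equivb_trans.

Definition coll := {eq_quot coll_equivb}.

(* repr x is an arbitrary representative of the class x; the value does not
   depend on it, see coll_char_pi. *)
Definition coll_char (x : coll) : {fraction {poly K}} :=
  finmx_char (repr x).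

Lemma coll_char_pi g : coll_char (\pi g) = finmx_char g.
Proof.
apply: finmx_char_equiv; apply/asboolP.
by rewrite -/(coll_equivb _ _) -(@eqmodE _ coll_equiv_rel) reprK.
Qed.

End Coll.

(* Main.v *)
Require Import Defs.
From mathcomp Require Import all_boot all_order all_algebra fraction.
From mathcomp Require Import classical_sets cardinality.
From mathcomp Require Import generic_quotient.

Import GRing.Theory.
Local Open Scope ring_scope.

(* After scaling, [v.[0] = 1].  Take for [d] the companion matrix of the
   reversal of [v] and for [c] the first basis vector: the system
   [(1 - lambda d) x = c] is solved by [x_j = lambda^j / v].  Hence
   [a + lambda b x = u / v] as soon as [a v + \sum_j b_j lambda^(j+1) = u],
   which is solved by [a = u_0] and [b_j = u_(j+1) - u_0 v_(j+1)]. *)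

Lemma finmx_of_block (K : fieldType) (N : nat) (a : K) (b : 'rV[K]_N)
    (c : 'cV[K]_N) (d : 'M[K]_N) :
  exists g : finmx K, [/\ bounded N.+1 (entries g), coll_a g = a,
    coll_b N g = b, coll_c N g = c & coll_d N g = d].
Proof.
pose B : 'M[K]_(1 + N) := block_mx (const_mx a) b c d.
(* The bounds guard [inord], whose default value is therefore never reached. *)
pose A (i j : nat) : K := if (i < N.+1)%N && (j < N.+1)%N
  then B (inord i) (inord j) else (i == j)%:R.
have bA : bounded N.+1 A.
  move=> i j Nij; rewrite /A; case: ifP => // /andP[iN jN].
  by case/orP: Nij; rewrite leqNgt ?iN ?jN.
have [g gA] := entries_surj (ex_intro _ N.+1 bA).
exists g; rewrite gA.
have : corner N.+1 (entries g) = B.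
  by apply/matrixP => i j; rewrite gA !mxE /A !ltn_ord !inord_val !mxE.
rewrite corner_block => /(@eq_block_mx _ 1 N 1 N)[aE -> -> ->]; split=> //.
by move/matrixP/(_ 0 0): aE; rewrite !mxE.
Qed.

(** The resolvent matrix is invertible over the fraction field, so exhibiting one solution of the
    linear system replaces computing an inverse. *)
Lemma corner_char_eq (K : fieldType) (N : nat) (g : finmx K)
    (x : 'cV[{fraction {poly K}}]_N) :
  (1%:M - lambda K *: map_mx (ratC K) (coll_d N g)) *m x
    = map_mx (ratC K) (coll_c N g) ->
  corner_char N g = ratC K (coll_a g)
    + lambda K * (map_mx (ratC K) (coll_b N g) *m x) 0 0.
Proof.
move=> xE; rewrite /corner_char -xE -[in LHS]mulmxA mulKmx //.
exact: resolvent_unitmx.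
Qed.

Lemma poly_split0 (R : nzRingType) (N : nat) (p : {poly R}) :
  (size p <= N.+1)%N -> p = (p`_0)%:P + 'X * \poly_(j < N) p`_j.+1.
Proof.
move=> sp; apply/polyP => -[|i]; rewrite coefD coefC coefXM /= ?addr0 // add0r.
by rewrite coef_poly; case: ltnP => // Ni; rewrite nth_default ?(leq_trans sp).
Qed.

Lemma tofrac_poly (K : fieldType) (N : nat) (E : nat -> K) :
  tofrac (\poly_(j < N) E j) = \sum_(j < N) ratC K (E j) * lambda K ^+ j.
Proof.
rewrite poly_def rmorph_sum; apply: eq_bigr => j _.
by rewrite -mul_polyC rmorphM rmorphXn.
Qed.

Lemma realization (K : fieldType) (u v : {poly K}) :
  v`_0 = 1 -> exists g : finmx K, finmx_char g = tofrac u / tofrac v.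
Proof.
(* The blocks get size [N.+1], so that the index [0] exists even when [N] is not known to be
   positive; the extra coefficients vanish. *)
move=> v01; pose N := maxn (size u) (size v).
have vE : v = 1 + 'X * \poly_(j < N.+1) v`_j.+1.
  by rewrite [LHS](@poly_split0 _ N.+1) ?v01 // 2?leqW ?leq_maxr.
have uE : u = (u`_0)%:P + 'X * \poly_(j < N.+1) u`_j.+1.
  by rewrite [LHS](@poly_split0 _ N.+1) // 2?leqW ?leq_maxl.
have vn0 : tofrac v != 0 :> {fraction {poly K}}.
  rewrite tofrac_eq0; apply: contra_eq_neq v01 => ->.
  by rewrite coef0 eq_sym oner_eq0.
(* Row [0] of the system reads [x_0 + lambda * \sum_j v_(j+1) x_j = 1], and row [i.+1] reads
   [x_(i+1) = lambda * x_i]. *)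
pose d : 'M[K]_N.+1 := \matrix_(i, j)
  if i == 0 :> nat then - v`_j.+1 else (i == j.+1 :> nat)%:R.
have [g [bg aE bE cE dE]] := @finmx_of_block K N.+1 u`_0
  (\row_j (u`_j.+1 - u`_0 * v`_j.+1)) (delta_mx 0 0) d.
exists g; rewrite (corner_charE bg).
rewrite (@corner_char_eq _ _ _ (\col_j (lambda K ^+ j / tofrac v))).
  (* Clearing the denominator [v] leaves an identity between polynomials, in which [u_0] times the
     tail of [v] cancels. *)
  apply: (mulIf vn0); rewrite divfK // mulrDl aE bE mxE.
  rewrite -mulrA mulr_suml (eq_bigr (fun j : 'I_N.+1 =>
    ratC K (u`_j.+1 - u`_0 * v`_j.+1) * lambda K ^+ j)) => [|j _]; last first.
    by rewrite !mxE -mulrA divfK.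
  rewrite -(@tofrac_poly _ _ (fun j => u`_j.+1 - u`_0 * v`_j.+1)).
  rewrite [ratC K _]/(tofrac (u`_0)%:P) -!tofracM -tofracD; congr tofrac.
  have -> : \poly_(j < N.+1) (u`_j.+1 - u`_0 * v`_j.+1) =
      \poly_(j < N.+1) u`_j.+1 - (u`_0)%:P * \poly_(j < N.+1) v`_j.+1.
    apply/polyP => i; rewrite coefB coefCM !coef_poly.
    by case: ifP => // _; rewrite mulr0 subr0.
  rewrite [in RHS]uE [X in _ * X + _ = _]vE mulrDr mulr1 mulrBr -addrA; congr (_ + _).
  by rewrite mulrCA addrC subrK.
rewrite cE dE mulmxBl mul1mx -scalemxAl; apply/colP => i.
rewrite !mxE andbT; apply: (mulIf vn0); rewrite mulrBl divfK // -mulrA mulr_suml.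
(* Multiplied by [v], row [0] is the decomposition [vE]. *)
have [-> /=|i0] := eqVneq i 0.
  rewrite (eq_bigr (fun j : 'I_N.+1 => - (ratC K v`_j.+1 * lambda K ^+ j))).
    rewrite sumrN mulrN opprK -(@tofrac_poly _ _ (fun j => v`_j.+1)).
    by rewrite expr0 mul1r -tofracM -tofrac1 -tofracD -vE.
  by move=> j _; rewrite !mxE /= -mulrA divfK // !rmorphN mulNr.
case: i i0 => -[//|i] lti _; have iN : (i < N.+1)%N := ltnW lti.
(* Below row [0], only the subdiagonal entry contributes, and the two powers of [lambda] cancel. *)
rewrite (bigD1 (Ordinal iN)) //= big1 => [|j ji].
  by rewrite !mxE /= eqxx rmorph1 mul1r divfK // addr0 -exprS subrr mul0r.
by rewrite !mxE /= eqSS eq_sym (negPf (_ : (j : nat) != i)) ?rmorph0 ?mul0r.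
Qed.

Theorem proposition3p4 (K : fieldType)
    (K_not_closed : ~ GRing.closed_field_axiom K)
    (K_infinite : infinite_set [set: K]%classic)
    (w : {fraction {poly K}}) (u v : {poly K})
    (v0 : v.[0] != 0) (w_uv : w = @tofrac {poly K} u / @tofrac {poly K} v) :
  exists g : coll K, coll_char g = w.
Proof.
(* Scaling both polynomials by [k] makes the constant term of the denominator [1] and preserves the
   quotient. *)
rewrite horner_coef0 in v0; pose k := (v`_0)^-1.
have [g gE] : exists g : finmx K,
    finmx_char g = tofrac (k%:P * u) / tofrac (k%:P * v).
  by apply: realization; rewrite coefCM mulVf.
exists (\pi_(coll K) g)%qT; rewrite coll_char_pi gE w_uv !rmorphM /=.
by rewrite -mulf_div divff ?mul1r // tofrac_eq0 polyC_eq0 invr_eq0.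
Qed.
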